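(* Let $k\in\mathbb{N}$. Then there exists a continuous linear operator $\mathfrak{a}_k^{\dag}\colon \mathcal{S}^*(Z) \rightarrow \mathcal{S}^*(Z)$ (continuous for the strong topology) such that $$\widehat{\mathfrak{a}_k^{\dag}\Phi}(\sigma)=\mathbf{1}_{\sigma}(k)\,\widehat{\Phi}(\sigma\setminus k),\quad \sigma\in\Gamma,\ \Phi\in\mathcal{S}^*(Z).$$
   Context: $\mathbb{N}=\{0,1,2,\dots\}$ and $\Gamma$ is the set of all finite subsets of $\mathbb{N}$; for $\sigma\in\Gamma$, $k\in\mathbb{N}$, write $\sigma\setminus k=\sigma\setminus\{k\}$ and $\mathbf{1}_\sigma$ for the indicator of $\sigma$. $(\Omega,\mathcal{F},P)$ is a probability space with expectation $\mathbb{E}$. A discrete-time normal noise is a sequence $Z=(Z_n)_{n\in\mathbb{N}}$ of integrable (real) random variables on $\Omega$ with $\mathbb{E}[Z_n\mid\mathcal{F}_{n-1}]=0$ and $\mathbb{E}[Z_n^2\mid\mathcal{F}_{n-1}]=1$ for all $n\ge 0$, where $\mathcal{F}_{-1}=\{\emptyset,\Omega\}$ and $\mathcal{F}_n=\sigma(Z_k;0\le k\le n)$. Put $Z_\emptyset=1$ and $Z_\sigma=\prod_{i\in\sigma}Z_i$ for nonempty $\sigma\in\Gamma$; $\{Z_\sigma\mid\sigma\in\Gamma\}$ is an orthonormal system. Let $\mathcal{F}_\infty=\sigma(Z_n;n\in\mathbb{N})$ and let $\mathcal{L}^2(Z)=\mathcal{L}^2(\Omega,\mathcal{F}_\infty,P)$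 (complex-valued functions), with inner product $\langle\cdot,\cdot\rangle$ conjugate-linear in the first and linear in the second argument. $Z$ is a fixed discrete-time normal noise having the chaotic representation property: $\{Z_\sigma\}$ is total in $\mathcal{L}^2(Z)$, hence an orthonormal basis of it. $\lambda_\emptyset=1$ and $\lambda_\sigma=\prod_{k\in\sigma}(k+1)$ for nonempty $\sigma\in\Gamma$. For real $p\ge0$, $\mathcal{S}_p(Z)=\{\xi\in\mathcal{L}^2(Z)\mid\|\xi\|_p^2:=\sum_{\sigma\in\Gamma}\lambda_\sigma^{2p}|\langle Z_\sigma,\xi\rangle|^2<\infty\}$, a Hilbert space. $\mathcal{S}(Z)=\bigcap_{p\ge0}\mathcal{S}_p(Z)$ has the topology generated by the norms $\|\cdot\|_p$, $p\ge 0$; it is a nuclear countably-Hilbert space containing every $Z_\sigma$. $\mathcal{S}^*(Z)$ is the dual (continuous linear functionals) of $\mathcal{S}(Z)$ with the strong topology. For $\Phi\in\mathcal{S}^*(Z)$, its Fock transform is the function $\widehat\Phi(\sigma)=\Phi(Z_\sigma)$, $\sigma\in\Gamma$; $\Phi$ is determined by $\widehat\Phi$. *)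

(* Defs.v *)
From HB Require Import structures.
From mathcomp Require Import all_boot all_order all_algebra.
From mathcomp Require Import finmap generic_quotient.
From mathcomp Require Import all_classical all_reals all_analysis measurable_realfun.
From mathcomp Require Import ring lra.
From mathcomp Require Import complex.

Set Implicit Arguments.
Unset Strict Implicit.
Unset Printing Implicit Defensive.

Import Order.TTheory GRing.Theory Num.Theory.
Import numFieldNormedType.Exports.
Import ComplexField.Normc.

Local Open Scope classical_set_scope.
Local Open Scope ring_scope.
Local Open Scope complex_scope.
(* Num.Theory also exports Re and Im, for numClosedFieldType. *)
Local Notation Re := (@complex.Re _).
Local Notation Im := (@complex.Im _).

Section CondExpectation.
Context d (T : measurableType d) (R : realType) (P : probability T R).

(* Y is a version of E[X | <<s G >>]. Both functions are required to be
   integrable, so that E[X | <<s G >>] = 1 includes the integrability of X. *)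
Definition is_cond_expectation (G : set_system T) (X Y : T -> R) : Prop :=
  [/\ P.-integrable setT (EFin \o X),
      measurable_fun setT (Y : g_sigma_algebraType G -> R),
      P.-integrable setT (EFin \o Y) &
      forall A, <<s G >> A ->
        (\int[P]_(x in A) (X x)%:E = \int[P]_(x in A) (Y x)%:E)%E].

(* Generators of the sigma-algebra of the Z_i, i \in I: F_(n-1) is
   <<s history Z [set k | k < n] >>, which is the trivial sigma-algebra for
   n = 0, and F_oo is <<s history Z setT >>. *)
Definition history (Z : nat -> {RV P >-> R}) (I : set nat) : set_system T :=
  \bigcup_(i in I) preimage_set_system setT (Z i) measurable.

Record normal_noise := NormalNoise {
  noise :> nat -> {RV P >-> R} ;
  noise_integrable : forall n, P.-integrable setT (EFin \o noise n) ;
  noise_mean : forall n,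
    is_cond_expectation (history noise [set k | (k < n)%N])
      (noise n) (cst 0) ;
  noise_var : forall n,
    is_cond_expectation (history noise [set k | (k < n)%N])
      (fun x => noise n x ^+ 2) (cst 1)
}.

End CondExpectation.

Section MulIntegral.
Context d (T : measurableType d) (R : realType) (P : probability T R).
Variable (G : set_system T).
Hypothesis mG : G `<=` measurable.
Import HBNNSimple.

Lemma sub_gsigma : <<s G >> `<=` measurable.
Proof. by apply: smallest_sub => //; exact: sigma_algebra_measurable. Qed.

Lemma gsigma_measurable_fun (Y : T -> R) :
  measurable_fun setT (Y : g_sigma_algebraType G -> R) -> measurable_fun setT Y.
Proof.
move=> mY _ B mB; apply: sub_gsigma.
exact: (mY (@measurableT _ _) B mB).
Qed.

Local Open Scope ereal_scope.

Let ge0_int_approx (X : T -> R) (h : T -> R)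
  (mX : measurable_fun setT X) (X0 : forall x, (0 <= X x)%R)
  (mh0 : measurable_fun setT (h : g_sigma_algebraType G -> R))
  (h0 : forall x, (0 <= h x)%R) :
  let mh := (measurable_EFinP _ _).2 mh0 in
  let hn := nnsfun_approx (@measurableT _ (g_sigma_algebraType G)) mh in
  \int[P]_x (h x * X x)%:E = limn (fun n =>
    \sum_(r \in range (hn n)) (r%:E * \int[P]_(x in hn n @^-1` [set r]) (X x)%:E)).
Proof.
move=> mh hn.
have mhn n : measurable_fun setT (hn n : T -> R).
  by apply: gsigma_measurable_fun; exact/measurable_funP.
have mpre n r : measurable (hn n @^-1` [set r] : set T).
  by rewrite -[X in measurable X]setTI; exact: mhn.
transitivity (\int[P]_x limn (fun n => (hn n x * X x)%:E)).
  apply: eq_integral => x _; apply/esym/cvg_lim => //.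
  rewrite EFinM; under eq_fun do rewrite EFinM.
  apply: cvgeZr => //.
  apply: cvg_nnsfun_approx => // y _; by rewrite lee_fin.
rewrite monotone_convergence//; last 3 first.
- by move=> n; apply/measurable_EFinP; apply: measurable_funM.
- by move=> n x _; rewrite lee_fin mulr_ge0.
- move=> x _ a b ab; rewrite lee_fin ler_wpM2r//.
  by have /lefP /(_ x) := @nd_nnsfun_approx _ (g_sigma_algebraType G) _ _
    (@measurableT _ _) _ mh _ _ ab.
congr (limn _); apply/funext => n.
transitivity (\int[P]_x
    \sum_(r \in range (hn n)) ((r * \1_(hn n @^-1` [set r]) x)%:E * (X x)%:E)).
  apply: eq_integral => x _.
  rewrite -ge0_mule_fsuml; last by move=> r; exact: nnfun_muleindic_ge0.
  by rewrite fsumEFin// -(fimfunE (hn n) x) -EFinM.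
rewrite ge0_integral_fsum//; last 2 first.
- move=> r; apply: emeasurable_funM; apply/measurable_EFinP => //.
  by apply: measurable_funM => //; exact: measurable_indic.
- by move=> r x _; rewrite mule_ge0 ?lee_fin// -lee_fin nnfun_muleindic_ge0.
apply: eq_fsbigr => r; rewrite inE => -[t _ <-].
under eq_integral do rewrite EFinM -muleA.
rewrite ge0_integralZl//.
- congr (_ * _).
  rewrite [RHS]integral_mkcond; apply: eq_integral => x _.
  by rewrite epatch_indic muleC.
- apply: emeasurable_funM; apply/measurable_EFinP => //; exact: measurable_indic.
- by move=> x _; rewrite mule_ge0 ?lee_fin.
- by rewrite lee_fin.
Qed.

Lemma ge0_int_gsigmaM (X Y : T -> R) (h : T -> R) :
  measurable_fun setT X -> measurable_fun setT Y ->
  (forall x, 0 <= X x)%R -> (forall x, 0 <= Y x)%R ->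
  (forall A, <<s G >> A -> \int[P]_(x in A) (X x)%:E = \int[P]_(x in A) (Y x)%:E) ->
  measurable_fun setT (h : g_sigma_algebraType G -> R) -> (forall x, 0 <= h x)%R ->
  \int[P]_x (h x * X x)%:E = \int[P]_x (h x * Y x)%:E.
Proof.
move=> mX mY X0 Y0 XY mh h0.
rewrite (ge0_int_approx mX X0 mh h0) (ge0_int_approx mY Y0 mh h0).
congr (limn _); apply/funext => n; apply: eq_fsbigr => r _; congr (_ * _).
apply: XY.
set f := nnsfun_approx _ _ _.
have mf : measurable_fun setT (f : g_sigma_algebraType G -> R) by exact/measurable_funP.
rewrite -[X in <<s _ >> X]setTI.
exact: (mf (@measurableT _ _) [set r] (measurable_set1 r)).
Qed.

End MulIntegral.

Section MulIntegralSigned.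
Context d (T : measurableType d) (R : realType) (P : probability T R).
Variable (G : set_system T).
Hypothesis mG : G `<=` measurable.

Local Notation int f := (P.-integrable setT (EFin \o f)).
Local Open Scope ereal_scope.

Let int_fin (f : T -> R) A : measurable A -> int f ->
  \int[P]_(x in A) (f x)%:E \is a fin_num.
Proof.
move=> mA intf; apply: integrable_fin_num => //.
exact: integrableS intf.
Qed.

Let intD (f g : T -> R) : int f -> int g -> int (fun x => f x + g x)%R.
Proof. by move=> If Ig; exact: integrableD If Ig. Qed.

Let intN (f : T -> R) : int f -> int (fun x => `|f x|)%R.
Proof. by move=> If; exact: integrable_norm If. Qed.

Let integD (f g : T -> R) A : measurable A -> int f -> int g ->
  \int[P]_(x in A) (f x + g x)%:E =
  \int[P]_(x in A) (f x)%:E + \int[P]_(x in A) (g x)%:E.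
Proof.
move=> mA If Ig; rewrite -integralD//=.
- exact: integrableS If.
- exact: integrableS Ig.
Qed.

Let abs_h (h X : T -> R) : measurable_fun setT h -> measurable_fun setT X ->
  int (fun x => h x * X x)%R -> int (fun x => h x * `|X x|)%R.
Proof.
move=> mh mX; apply: le_integrable => //.
  apply/measurable_EFinP; apply: measurable_funM => //.
  exact: measurableT_comp.
by move=> x _ /=; rewrite lee_fin !normrM normr_id.
Qed.

Let step1 (X Y h : T -> R) : int X -> int Y ->
  (forall A, <<s G >> A -> \int[P]_(x in A) (X x)%:E = \int[P]_(x in A) (Y x)%:E) ->
  measurable_fun setT (h : g_sigma_algebraType G -> R) -> (forall x, 0 <= h x)%R ->
  int (fun x => h x * X x)%R -> int (fun x => h x * Y x)%R ->
  \int[P]_x (h x * X x)%:E = \int[P]_x (h x * Y x)%:E.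
Proof.
move=> IX IY XY mh h0 IhX IhY.
have mh' := gsigma_measurable_fun mG mh.
have mX : measurable_fun setT X by apply/measurable_EFinP; exact: measurable_int IX.
have mY : measurable_fun setT Y by apply/measurable_EFinP; exact: measurable_int IY.
pose W x := (`|X x| + `|Y x|)%R.
have IW : int W by apply: intD; exact: intN.
have IhW : int (fun x => h x * W x)%R.
  rewrite (_ : (fun x => _) = (fun x => h x * `|X x| + h x * `|Y x|)%R); last first.
    by apply/funext => x; rewrite mulrDr.
  by apply: intD; exact: abs_h.
have mW : measurable_fun setT W by apply/measurable_EFinP; exact: measurable_int IW.
have : \int[P]_x (h x * (X x + W x))%:E = \int[P]_x (h x * (Y x + W x))%:E.
  apply: (ge0_int_gsigmaM mG) => //.
  - exact: measurable_funD.
  - exact: measurable_funD.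
  - by move=> x; rewrite /W; have := normr_ge0 (Y x); have := lerNnormlW (lexx `|X x|%R); lra.
  - by move=> x; rewrite /W; have := normr_ge0 (X x); have := lerNnormlW (lexx `|Y x|%R); lra.
  - move=> A GA; have mA := sub_gsigma mG GA.
    by rewrite (integD mA IX IW) (integD mA IY IW) (XY _ GA).
under eq_integral do rewrite mulrDr.
under [in RHS]eq_integral do rewrite mulrDr.
rewrite !integD//.
have wf := int_fin measurableT IhW.
by move=> /(congr1 (fun z => z - \int[P]_x (h x * W x)%:E)); rewrite !addeK.
Qed.

Lemma int_gsigmaM (X Y h : T -> R) : int X -> int Y ->
  (forall A, <<s G >> A -> \int[P]_(x in A) (X x)%:E = \int[P]_(x in A) (Y x)%:E) ->
  measurable_fun setT (h : g_sigma_algebraType G -> R) ->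
  int (fun x => h x * X x)%R -> int (fun x => h x * Y x)%R ->
  \int[P]_x (h x * X x)%:E = \int[P]_x (h x * Y x)%:E.
Proof.
move=> IX IY XY mh IhX IhY.
have mh' := gsigma_measurable_fun mG mh.
have mX : measurable_fun setT X by apply/measurable_EFinP; exact: measurable_int IX.
have mY : measurable_fun setT Y by apply/measurable_EFinP; exact: measurable_int IY.
have mah : measurable_fun setT ((fun x => `|h x|%R) : g_sigma_algebraType G -> R).
  exact: measurableT_comp.
have Ia Z : measurable_fun setT Z -> int (fun x => h x * Z x)%R -> int (fun x => `|h x| * Z x)%R.
  move=> mZ; apply: le_integrable => //.
    apply/measurable_EFinP; apply: measurable_funM => //.
    exact: measurableT_comp.
  by move=> x _ /=; rewrite lee_fin !normrM normr_id.
have E1 : \int[P]_x (`|h x| * X x)%:E = \int[P]_x (`|h x| * Y x)%:E.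
  by apply: step1 => //; exact: Ia.
have E2 : \int[P]_x ((h x + `|h x|) * X x)%:E = \int[P]_x ((h x + `|h x|) * Y x)%:E.
  apply: step1 => //.
  - exact: measurable_funD.
  - by move=> x; have := lerNnormlW (lexx `|h x|%R); lra.
  - rewrite (_ : (fun x => _) = (fun x => h x * X x + `|h x| * X x)%R); last first.
      by apply/funext => x; rewrite mulrDl.
    by apply: intD => //; exact: Ia.
  - rewrite (_ : (fun x => _) = (fun x => h x * Y x + `|h x| * Y x)%R); last first.
      by apply/funext => x; rewrite mulrDl.
    by apply: intD => //; exact: Ia.
move: E2.
under eq_integral do rewrite mulrDl.
under [in RHS]eq_integral do rewrite mulrDl.
have IaX := Ia _ mX IhX.
rewrite !integD//; last exact: Ia.
rewrite -E1.
have wf := int_fin measurableT IaX.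
by move=> /(congr1 (fun z => z - \int[P]_x (`|h x|%R * X x)%:E)); rewrite !addeK.
Qed.

End MulIntegralSigned.

Section NoiseProd.
Context d (T : measurableType d) (R : realType) (P : probability T R).
Variable Z : normal_noise P.

Definition noise_prod (s : {fset nat}) : T -> R :=
  fun x => \prod_(i <- s) Z i x.

Lemma history_measurable I : history Z I `<=` measurable.
Proof.
move=> A [i _ [B mB <-]]; exact: (measurable_funP (Z i)).
Qed.

Lemma history_noise I i : I i ->
  measurable_fun setT (Z i : g_sigma_algebraType (history Z I) -> R).
Proof.
move=> Ii _ B mB; apply: sub_sigma_algebra.
by exists i => //; exists B.
Qed.

Lemma measurable_noise_prod I (s : {fset nat}) : (forall i, i \in s -> I i) ->
  measurable_fun setT (noise_prod s : g_sigma_algebraType (history Z I) -> R).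
Proof.
move=> sI; apply: measurable_prod => i si.
exact: history_noise (sI _ si).
Qed.

Let mprod s : measurable_fun setT (noise_prod s).
Proof.
by apply: (gsigma_measurable_fun (@history_measurable setT)); exact: measurable_noise_prod.
Qed.

Let prodD1 (s : {fset nat}) n : n \in s ->
  noise_prod s = (fun x => noise_prod (s `\ n)%fset x * Z n x).
Proof.
by move=> ns; apply/funext => x; rewrite /noise_prod (big_fsetD1 n)//= mulrC.
Qed.

Let bdD1 (s : {fset nat}) n : (forall i, i \in s -> (i < n.+1)%N) ->
  forall i, i \in (s `\ n)%fset -> (i < n)%N.
Proof.
move=> sn i; rewrite in_fsetD1 => /andP[iN /sn].
by rewrite ltnS leq_eqVlt (negbTE iN).
Qed.

Let bdN (s : {fset nat}) n : (forall i, i \in s -> (i < n.+1)%N) -> n \notin s ->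
  forall i, i \in s -> (i < n)%N.
Proof.
move=> sn ns i si; have := sn _ si; rewrite ltnS leq_eqVlt => /orP[/eqP E|//].
by rewrite -E si in ns.
Qed.

Let bd0 (s : {fset nat}) : (forall i, i \in s -> (i < 0)%N) -> s = fset0.
Proof. by move=> s0; apply/fsetP => i; rewrite inE; apply/negP => /s0. Qed.

Let bd (s : {fset nat}) : exists n, forall i, i \in s -> (i < n)%N.
Proof.
exists (\sum_(i <- s) i).+1 => i si; rewrite ltnS (big_fsetD1 i)//=.
exact: leq_addr.
Qed.

Let norm_bd n (s : {fset nat}) : (forall i, i \in s -> (i < n)%N) ->
  (\int[P]_x (noise_prod s x ^+ 2)%:E = 1)%E.
Proof.
elim: n s => [|n IH] s sn.
  rewrite (bd0 sn); under eq_integral do rewrite /noise_prod big_seq_fset0 expr1n.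
  rewrite integral_cst// mul1e. exact: probability_setT.
have [ns|ns] := boolP (n \in s); last exact: IH (bdN sn ns).
rewrite (prodD1 ns).
under eq_integral do rewrite exprMn.
have [_ _ _ E] := noise_var Z n.
rewrite (ge0_int_gsigmaM (@history_measurable [set k | (k < n)%N]) _ _ _ _ E)//.
- by under eq_integral do rewrite /= mulr1; exact: IH (bdD1 sn).
- exact: measurable_funX.
- by move=> x; exact: sqr_ge0.
- by apply: measurable_funX; apply: measurable_noise_prod; exact: bdD1.
- by move=> x; exact: sqr_ge0.
Qed.

Lemma noise_prod_norm s : (\int[P]_x (noise_prod s x ^+ 2)%:E = 1)%E.
Proof. by have [n] := bd s; exact: norm_bd. Qed.

Let int_sqr s : P.-integrable setT (EFin \o (fun x => noise_prod s x ^+ 2)).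
Proof.
apply/integrableP; split; first by apply/measurable_EFinP; exact: measurable_funX.
under eq_integral do rewrite /= ger0_norm ?sqr_ge0//.
by rewrite noise_prod_norm ltry.
Qed.

Lemma integrable_noise_prodM s t :
  P.-integrable setT (EFin \o (fun x => noise_prod s x * noise_prod t x)).
Proof.
apply: (le_integrable _ _ _ (integrableD _ (int_sqr s) (int_sqr t))) => //.
  by apply/measurable_EFinP; exact: measurable_funM.
move=> x _ /=; rewrite lee_fin.
rewrite [leRHS]ger0_norm ?addr_ge0 ?sqr_ge0//.
by rewrite ler_norml; apply/andP; split; nra.
Qed.

Let orth_bd n (s t : {fset nat}) : (forall i, i \in s -> (i < n)%N) -> (forall i, i \in t -> (i < n)%N) ->
  s != t -> (\int[P]_x (noise_prod s x * noise_prod t x)%:E = 0)%E.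
Proof.
have H1 m (u v : {fset nat}) : (forall i, i \in u -> (i < m.+1)%N) -> m \in u ->
    (forall i, i \in v -> (i < m)%N) ->
    (\int[P]_x (noise_prod u x * noise_prod v x)%:E = 0)%E.
  move=> um mu vm.
  have I1 := integrable_noise_prodM u v.
  move: I1; rewrite (prodD1 mu).
  rewrite (_ : (fun x => _ * _ * _) =
    (fun x => (noise_prod (u `\ m)%fset x * noise_prod v x) * Z m x)); last first.
    by apply/funext => x; rewrite mulrAC.
  move=> I1.
  under eq_integral do rewrite mulrAC.
  have [IX _ IY E] := noise_mean Z m.
  rewrite (int_gsigmaM (@history_measurable [set k | (k < m)%N]) IX IY E)//.
  - by under eq_integral do rewrite mulr0; rewrite integral0.
  - by apply: measurable_funM; apply: measurable_noise_prod => //; exact: bdD1.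
  - rewrite (_ : (fun x => _) = cst 0); first exact: IY.
    by apply/funext => x /=; rewrite mulr0.
elim: n s t => [|n IH] s t sn tn st.
  by move: st; rewrite (bd0 sn) (bd0 tn) eqxx.
have [ns|ns] := boolP (n \in s); have [nt|nt] := boolP (n \in t).
- have st' : (s `\ n)%fset != (t `\ n)%fset.
    apply: contraNneq st => E; apply/eqP/fsetP => i.
    have [->|iN] := eqVneq i n; first by rewrite ns nt.
    by move/fsetP/(_ i) : E; rewrite !in_fsetD1 iN.
  have I1 := integrable_noise_prodM s t.
  move: I1; rewrite (prodD1 ns) (prodD1 nt).
  rewrite (_ : (fun x => _ * _ * _) =
    (fun x => (noise_prod (s `\ n)%fset x * noise_prod (t `\ n)%fset x) * Z n x ^+ 2)); last first.
    by apply/funext => x; ring.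
  move=> I1.
  under eq_integral do rewrite mulrACA -expr2.
  have [IX _ IY E] := noise_var Z n.
  rewrite (int_gsigmaM (@history_measurable [set k | (k < n)%N]) IX IY E)//.
  + under eq_integral do rewrite mulr1.
    exact: IH (bdD1 sn) (bdD1 tn) st'.
  + by apply: measurable_funM; apply: measurable_noise_prod; exact: bdD1.
  + rewrite (_ : (fun x => _) = (fun x => noise_prod (s `\ n)%fset x * noise_prod (t `\ n)%fset x)).
      exact: integrable_noise_prodM.
    by apply/funext => x /=; rewrite mulr1.
- exact: H1 (bdN tn nt).
- by under eq_integral do rewrite mulrC; exact: H1 tn nt (bdN sn ns).
- exact: IH (bdN sn ns) (bdN tn nt) st.
Qed.

Lemma noise_prod_orth s t : s != t ->
  (\int[P]_x (noise_prod s x * noise_prod t x)%:E = 0)%E.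
Proof.
have [n sn] := bd s; have [m tm] := bd t; apply: (@orth_bd (n + m)%N) => i.
- by move=> /sn; exact: ltn_addr.
- by move=> /tm; exact: ltn_addl.
Qed.

End NoiseProd.

Section L2.
Context d (T : measurableType d) (R : realType) (P : probability T R).
Variable Z : normal_noise P.

(* Measurability is with respect to F_oo, not to the sigma-algebra of T. *)
Definition sqint_fun_pred : {pred T -> R[i]} := mem [set f |
  [/\ measurable_fun setT ((fun x => Re (f x)) : g_sigma_algebraType (history Z setT) -> R),
      measurable_fun setT ((fun x => Im (f x)) : g_sigma_algebraType (history Z setT) -> R) &
      (\int[P]_x (normc (f x) ^+ 2)%:E < +oo)%E]].

Lemma normc_sqr (z : R[i]) : normc z ^+ 2 = Re z ^+ 2 + Im z ^+ 2.
Proof. by case: z => a b /=; rewrite sqr_sqrtr// addr_ge0 ?sqr_ge0. Qed.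

Let mg (f : T -> R) : measurable_fun setT (f : g_sigma_algebraType (history Z setT) -> R) ->
  measurable_fun setT f.
Proof. exact: (gsigma_measurable_fun (@history_measurable _ _ _ _ _ _)). Qed.

Lemma sqint_funP (f : T -> R[i]) : f \in sqint_fun_pred <->
  [/\ measurable_fun setT ((fun x => Re (f x)) : g_sigma_algebraType (history Z setT) -> R),
      measurable_fun setT ((fun x => Im (f x)) : g_sigma_algebraType (history Z setT) -> R),
      P.-integrable setT (EFin \o (fun x => Re (f x) ^+ 2)) &
      P.-integrable setT (EFin \o (fun x => Im (f x) ^+ 2))].
Proof.
have NE x : normc (f x) ^+ 2 = Re (f x) ^+ 2 + Im (f x) ^+ 2 by exact: normc_sqr.
rewrite inE/=; split=> [[mr mi fi]|[mr mi ir ii]].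
- have If : P.-integrable setT (EFin \o (fun x => normc (f x) ^+ 2)).
    apply/integrableP; split.
      apply/measurable_EFinP; under eq_fun do rewrite NE.
      by apply: measurable_funD; apply: measurable_funX; exact: mg.
    by under eq_integral do rewrite /= ger0_norm ?sqr_ge0//.
  split => //; apply: (le_integrable _ _ _ If) => //.
  + by apply/measurable_EFinP; apply: measurable_funX; exact: mg.
  + move=> x _ /=; rewrite lee_fin NE !ger0_norm ?addr_ge0 ?sqr_ge0//.
    by rewrite lerDl sqr_ge0.
  + by apply/measurable_EFinP; apply: measurable_funX; exact: mg.
  + move=> x _ /=; rewrite lee_fin NE !ger0_norm ?addr_ge0 ?sqr_ge0//.
    by rewrite lerDr sqr_ge0.
- split => //; under eq_integral do rewrite NE.
  have /integrableP[_] := integrableD measurableT ir ii.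
  by under eq_integral do rewrite /= ger0_norm ?addr_ge0 ?sqr_ge0//.
Qed.

Lemma sqint_fun_submod_closed : submod_closed sqint_fun_pred.
Proof.
split=> [|a f g /sqint_funP[fr fi fr2 fi2] /sqint_funP[gr gi gr2 gi2]].
  apply/sqint_funP; split => /=; try exact: measurable_cst.
  - by rewrite (_ : _ \o _ = cst 0); [exact: integrable0|apply/funext => x; rewrite /= expr0n].
  - by rewrite (_ : _ \o _ = cst 0); [exact: integrable0|apply/funext => x; rewrite /= expr0n].
have RE x : Re ((a *: f + g) x) = Re a * Re (f x) - Im a * Im (f x) + Re (g x).
  by rewrite /GRing.scale /GRing.add /=; case: (f x) (g x) a => [? ?] [? ?] [? ?].
have IE x : Im ((a *: f + g) x) = Re a * Im (f x) + Im a * Re (f x) + Im (g x).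
  by rewrite /GRing.scale /GRing.add /=; case: (f x) (g x) a {RE} => [? ?] [? ?] [? ?].
have mr : measurable_fun setT ((fun x => Re ((a *: f + g) x)) : g_sigma_algebraType (history Z setT) -> R).
  under eq_fun do rewrite RE.
  by apply: measurable_funD => //; apply: measurable_funB; apply: measurable_funM.
have mi : measurable_fun setT ((fun x => Im ((a *: f + g) x)) : g_sigma_algebraType (history Z setT) -> R).
  under eq_fun do rewrite IE.
  by apply: measurable_funD => //; apply: measurable_funD; apply: measurable_funM.
pose c := 4 * (Re a ^+ 2 + Im a ^+ 2) + 4.
pose B x := c * (Re (f x) ^+ 2 + Im (f x) ^+ 2 + (Re (g x) ^+ 2 + Im (g x) ^+ 2)).
have IB : P.-integrable setT (EFin \o B).
  have := integrableZl measurableT c (integrableD measurableT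
    (integrableD measurableT fr2 fi2) (integrableD measurableT gr2 gi2)).
  exact.
have key (p q u v w : R) : (p * u - q * v + w) ^+ 2 <=
    (4 * (p ^+ 2 + q ^+ 2) + 4) * (u ^+ 2 + v ^+ 2 + w ^+ 2).
  have h1 : (p * u - q * v) ^+ 2 <= (p ^+ 2 + q ^+ 2) * (u ^+ 2 + v ^+ 2).
    rewrite -subr_ge0 [X in 0 <= X](_ : _ = (p * v + q * u) ^+ 2) ?sqr_ge0//; ring.
  set e := p * u - q * v in h1 *; set s := p ^+ 2 + q ^+ 2 in h1 *.
  have s0 : 0 <= s by rewrite addr_ge0 ?sqr_ge0.
  have h2 : (e + w) ^+ 2 <= 2 * e ^+ 2 + 2 * w ^+ 2.
    rewrite -subr_ge0 [X in 0 <= X](_ : _ = (e - w) ^+ 2) ?sqr_ge0//; ring.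
  have u0 := sqr_ge0 u; have v0 := sqr_ge0 v; have w0 := sqr_ge0 w.
  have sw := mulr_ge0 s0 w0; have suv := mulr_ge0 s0 (addr_ge0 u0 v0).
  by nra.
apply/sqint_funP; split => //.
- apply: (le_integrable _ _ _ IB) => //.
    by apply/measurable_EFinP; apply: measurable_funX; exact: mg.
  move=> x _ /=; rewrite lee_fin [X in X <= _]ger0_norm ?sqr_ge0//.
  apply: le_trans (ler_norm _); rewrite RE.
  apply: (le_trans (key _ _ _ _ _)); rewrite ler_wpM2l// ?lerD2l ?lerDl ?sqr_ge0//.
  by rewrite addr_ge0// mulr_ge0// addr_ge0 ?sqr_ge0.
- apply: (le_integrable _ _ _ IB) => //.
    by apply/measurable_EFinP; apply: measurable_funX; exact: mg.
  move=> x _ /=; rewrite lee_fin [X in X <= _]ger0_norm ?sqr_ge0//.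
  apply: le_trans (ler_norm _); rewrite IE -[Im a * _]opprK -mulNr.
  apply: (le_trans (key _ _ _ _ _)); rewrite sqrrN [Im (f x) ^+ 2 + _]addrC.
  rewrite ler_wpM2l// ?lerD2l ?lerDr ?sqr_ge0//.
  by rewrite addr_ge0// mulr_ge0// addr_ge0 ?sqr_ge0.
Qed.

HB.instance Definition _ := GRing.isSubmodClosed.Build R[i] (T -> R[i])
  sqint_fun_pred sqint_fun_submod_closed.

Record sqint_fun := SqintFun {
  sqint_val :> T -> R[i] ;
  _ : sqint_val \in sqint_fun_pred }.

HB.instance Definition _ := [isSub for sqint_val].
HB.instance Definition _ := [Choice of sqint_fun by <:].
HB.instance Definition _ := [SubChoice_isSubLmodule of sqint_fun by <:].

Definition ae_eqb (f g : sqint_fun) : bool := `[< {ae P, forall x, f x = g x} >].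

Let ae_eqb_refl : reflexive ae_eqb.
Proof. by move=> f; apply/asboolP; exact: aeW. Qed.

Let ae_eqb_sym : symmetric ae_eqb.
Proof.
move=> f g; apply/idP/idP => /asboolP h; apply/asboolP;
  by apply: filterS h => x ->.
Qed.

Let ae_eqb_trans : transitive ae_eqb.
Proof.
move=> f g h /asboolP gf /asboolP fh; apply/asboolP.
by apply: filterS2 gf fh => x -> ->.
Qed.

Canonical ae_eqb_equiv := EquivRel ae_eqb ae_eqb_refl ae_eqb_sym ae_eqb_trans.

Local Open Scope quotient_scope.

(* Complex L^2(T, F_oo, P): square-integrable functions modulo almost
   everywhere equality. *)
Definition L2 : Type := {eq_quot ae_eqb}.
HB.instance Definition _ := Choice.on L2.
HB.instance Definition _ := EqQuotient.on L2.

Definition L2class (f : sqint_fun) : L2 := \pi_L2 f.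

Lemma L2classP (f g : sqint_fun) :
  L2class f = L2class g <-> {ae P, forall x, f x = g x}.
Proof.
rewrite /L2class; split=> [/eqP|h]; first by rewrite eqmodE => /asboolP.
by apply/eqP; rewrite eqmodE; apply/asboolP.
Qed.

Lemma L2_reprK (xi : L2) : L2class (repr xi) = xi.
Proof. exact: reprK. Qed.

Lemma repr_L2class f : {ae P, forall x, (repr (L2class f) : sqint_fun) x = f x}.
Proof. by apply/L2classP; rewrite L2_reprK. Qed.

Definition L2_zero : L2 := L2class 0.
Definition L2_add (xi eta : L2) : L2 := L2class (repr xi + repr eta).
Definition L2_opp (xi : L2) : L2 := L2class (- repr xi).
Definition L2_scale (a : R[i]) (xi : L2) : L2 := L2class (a *: repr xi).

Let addE f g : L2_add (L2class f) (L2class g) = L2class (f + g).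
Proof.
apply/L2classP; apply: filterS2 (repr_L2class f) (repr_L2class g) => x.
by rewrite /GRing.add /= /GRing.add /= => -> ->.
Qed.

Let oppE f : L2_opp (L2class f) = L2class (- f).
Proof.
apply/L2classP; apply: filterS (repr_L2class f) => x.
by rewrite /GRing.opp /= /GRing.opp /= => ->.
Qed.

Let scaleE a f : L2_scale a (L2class f) = L2class (a *: f).
Proof.
apply/L2classP; apply: filterS (repr_L2class f) => x.
by rewrite /GRing.scale /= /GRing.scale /= => ->.
Qed.

Let L2_addA : associative L2_add.
Proof.
move=> x y z; rewrite -(L2_reprK x) -(L2_reprK y) -(L2_reprK z).
by rewrite !addE addrA.
Qed.

Let L2_addC : commutative L2_add.
Proof. by move=> x y; rewrite -(L2_reprK x) -(L2_reprK y) !addE addrC. Qed.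

Let L2_add0 : left_id L2_zero L2_add.
Proof. by move=> x; rewrite -(L2_reprK x) addE add0r. Qed.

Let L2_addN : left_inverse L2_zero L2_opp L2_add.
Proof. by move=> x; rewrite -(L2_reprK x) oppE addE addNr. Qed.

HB.instance Definition _ := GRing.isZmodule.Build L2 L2_addA L2_addC L2_add0 L2_addN.

Let L2_scaleA a b x : L2_scale a (L2_scale b x) = L2_scale (a * b) x.
Proof. by rewrite -(L2_reprK x) !scaleE scalerA. Qed.

Let L2_scale1 : left_id 1 L2_scale.
Proof. by move=> x; rewrite -(L2_reprK x) scaleE scale1r. Qed.

Let L2_scaleDr : right_distributive L2_scale +%R.
Proof.
move=> a x y; rewrite -(L2_reprK x) -(L2_reprK y) /GRing.add /=.
by rewrite !(scaleE, addE) scalerDr.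
Qed.

Let L2_scaleDl x : {morph L2_scale^~ x : a b / a + b}.
Proof.
by move=> a b; rewrite -(L2_reprK x) [in RHS]/GRing.add /= !(scaleE, addE) scalerDl.
Qed.

HB.instance Definition _ := GRing.Zmodule_isLmodule.Build R[i] L2
  L2_scaleA L2_scale1 L2_scaleDr L2_scaleDl.

Lemma L2classD f g : L2class (f + g) = L2class f + L2class g.
Proof. by rewrite -addE. Qed.

Lemma L2classZ a f : L2class (a *: f) = a *: L2class f.
Proof. by rewrite -scaleE. Qed.

Definition cintegral (f : T -> R[i]) : R[i] :=
  (\int[P]_x Re (f x)) +i* (\int[P]_x Im (f x)).

(* Conjugate-linear in the first argument; independent of the choice of the
   representatives by L2_inner_class below. *)
Definition L2_inner (xi eta : L2) : R[i] :=
  cintegral (fun x => (repr xi x)^*%C * repr eta x).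

Definition L2_norm (xi : L2) : R := Num.sqrt (Re (L2_inner xi xi)).

End L2.

Section InnerProduct.
Context d (T : measurableType d) (R : realType) (P : probability T R).
Variable Z : normal_noise P.
Implicit Types f g h : sqint_fun Z.

Let sqP f := (sqint_funP Z f).1 (valP f).

Let mg (f : T -> R) : measurable_fun setT (f : g_sigma_algebraType (history Z setT) -> R) ->
  measurable_fun setT f.
Proof. exact: (gsigma_measurable_fun (@history_measurable _ _ _ _ _ _)). Qed.

Let mRe f : measurable_fun setT (fun x => Re (f x)).
Proof. by case: (sqP f) => m _ _ _; exact: mg. Qed.

Let mIm f : measurable_fun setT (fun x => Im (f x)).
Proof. by case: (sqP f) => _ m _ _; exact: mg. Qed.

Let intM (u v : T -> R) : measurable_fun setT u -> measurable_fun setT v ->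
  P.-integrable setT (EFin \o (fun x => u x ^+ 2)) ->
  P.-integrable setT (EFin \o (fun x => v x ^+ 2)) ->
  P.-integrable setT (EFin \o (fun x => u x * v x)).
Proof.
move=> mu mv iu iv; apply: (le_integrable _ _ _ (integrableD _ iu iv)) => //.
  by apply/measurable_EFinP; exact: measurable_funM.
move=> x _ /=; rewrite lee_fin.
rewrite [leRHS]ger0_norm ?addr_ge0 ?sqr_ge0//.
by rewrite ler_norml; apply/andP; split; nra.
Qed.

Let iZ (u : T -> R) a : P.-integrable setT (EFin \o u) ->
  P.-integrable setT (EFin \o (fun x => a * u x)).
Proof. by move=> iu; have := integrableZl measurableT a iu; exact. Qed.

Let iD (u v : T -> R) : P.-integrable setT (EFin \o u) -> P.-integrable setT (EFin \o v) ->
  P.-integrable setT (EFin \o (fun x => u x + v x)).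
Proof. by move=> iu iv; have := integrableD measurableT iu iv; exact. Qed.

Let iB (u v : T -> R) : P.-integrable setT (EFin \o u) -> P.-integrable setT (EFin \o v) ->
  P.-integrable setT (EFin \o (fun x => u x - v x)).
Proof. by move=> iu iv; have := integrableB measurableT iu iv; exact. Qed.

Let inner_fun f g x : R[i] := (f x)^*%C * g x.

Let ReE f g x : Re (inner_fun f g x) = Re (f x) * Re (g x) + Im (f x) * Im (g x).
Proof. by rewrite /inner_fun; case: (f x) (g x) => [? ?] [? ?] /=; ring. Qed.

Let ImE f g x : Im (inner_fun f g x) = Re (f x) * Im (g x) - Im (f x) * Re (g x).
Proof. by rewrite /inner_fun; case: (f x) (g x) => [? ?] [? ?] /=; ring. Qed.

Let iRe f g : P.-integrable setT (EFin \o (fun x => Re (inner_fun f g x))).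
Proof.
under [X in _ \o X]eq_fun do rewrite ReE.
have [_ _ f1 f2] := sqP f; have [_ _ g1 g2] := sqP g.
by apply: iD; apply: intM.
Qed.

Let iIm f g : P.-integrable setT (EFin \o (fun x => Im (inner_fun f g x))).
Proof.
under [X in _ \o X]eq_fun do rewrite ImE.
have [_ _ f1 f2] := sqP f; have [_ _ g1 g2] := sqP g.
by apply: iB; apply: intM.
Qed.

Lemma L2_inner_class f g :
  L2_inner (L2class f) (L2class g) = cintegral P (fun x => (f x)^*%C * g x).
Proof.
rewrite /L2_inner /cintegral -!/(inner_fun _ _ _).
have E : {ae P, forall x, inner_fun (repr (L2class f)) (repr (L2class g)) x = inner_fun f g x}.
  by apply: filterS2 (repr_L2class f) (repr_L2class g) => x; rewrite /inner_fun => -> ->.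
congr (_ +i* _); rewrite /Rintegral; congr fine; apply: ae_eq_integral => //.
- exact: measurable_int (iRe _ _).
- exact: measurable_int (iRe _ _).
- by apply: filterS E => x + _; rewrite /inner_fun => ->.
- exact: measurable_int (iIm _ _).
- exact: measurable_int (iIm _ _).
- by apply: filterS E => x + _; rewrite /inner_fun => ->.
Qed.

Let inner_funD f g h a x :
  inner_fun f (a *: g + h) x = a * inner_fun f g x + inner_fun f h x.
Proof.
rewrite /inner_fun /GRing.add /= /GRing.add /= /GRing.scale /= /GRing.scale /=.
by rewrite mulrDr mulrCA.
Qed.

Let RintD (u v : T -> R) : P.-integrable setT (EFin \o u) -> P.-integrable setT (EFin \o v) ->
  \int[P]_x (u x + v x) = \int[P]_x u x + \int[P]_x v x.
Proof. exact: RintegralD. Qed.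

Let RintZ (u : T -> R) a : P.-integrable setT (EFin \o u) ->
  \int[P]_x (a * u x) = a * \int[P]_x u x.
Proof. exact: RintegralZl. Qed.

Lemma L2_inner_linear (xi : L2 Z) : linear_for *%R (L2_inner xi).
Proof.
move=> a eta zeta.
rewrite -(L2_reprK xi) -(L2_reprK eta) -(L2_reprK zeta) -L2classZ -L2classD.
rewrite !L2_inner_class.
set f := repr xi; set g := repr eta; set h := repr zeta.
rewrite /cintegral.
under eq_Rintegral do rewrite -/(inner_fun _ _ _) inner_funD.
under [X in _ +i* X]eq_Rintegral do rewrite -/(inner_fun _ _ _) inner_funD.
have Ere x : Re (a * inner_fun f g x + inner_fun f h x) =
    (Re a * Re (inner_fun f g x) + (- Im a) * Im (inner_fun f g x)) + Re (inner_fun f h x).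
  by case: (inner_fun f g x) (inner_fun f h x) (a) => [? ?] [? ?] [? ?] /=; ring.
have Eim x : Im (a * inner_fun f g x + inner_fun f h x) =
    (Re a * Im (inner_fun f g x) + Im a * Re (inner_fun f g x)) + Im (inner_fun f h x).
  by case: (inner_fun f g x) (inner_fun f h x) (a) => [? ?] [? ?] [? ?] /=; ring.
under eq_Rintegral do rewrite Ere.
under [X in _ +i* X]eq_Rintegral do rewrite Eim.
have i1 := iRe f g; have i2 := iIm f g; have i3 := iRe f h; have i4 := iIm f h.
rewrite !RintD//; do ?[exact: iZ | by apply: iD; exact: iZ].
rewrite !RintZ//.
by rewrite /inner_fun; case: a {Ere Eim} => p q; simpc; congr (_ +i* _); ring.
Qed.

Lemma noise_prod_sqint s : (fun x => (noise_prod Z s x)%:C) \in sqint_fun_pred Z.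
Proof.
apply/sqint_funP; split => /=.
- exact: measurable_noise_prod.
- exact: measurable_cst.
- by have := integrable_noise_prodM Z s s; under eq_fun do rewrite -expr2.
- by rewrite (_ : _ \o _ = cst 0); [exact: integrable0|apply/funext => x; rewrite /= expr0n].
Qed.

Definition noise_L2 (s : {fset nat}) : L2 Z := L2class (SqintFun (noise_prod_sqint s)).

(* The noise_L2 s are total: their linear span is dense in L2 Z. *)
Definition chaotic_representation : Prop :=
  forall (xi : L2 Z) (e : R), 0 < e ->
    exists (A : {fset {fset nat}}) (c : {fset nat} -> R[i]),
      L2_norm (xi - \sum_(s <- A) c s *: noise_L2 s) < e.

Lemma noise_L2_orthonormal s t : L2_inner (noise_L2 s) (noise_L2 t) = (s == t)%:R.
Proof.
rewrite L2_inner_class /cintegral /=.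
under eq_Rintegral do rewrite oppr0 mul0r subr0.
under [X in _ +i* X]eq_Rintegral do rewrite mulr0 oppr0 mul0r addr0.
have -> : \int[P]_x (noise_prod Z s x * noise_prod Z t x) = (s == t)%:R.
  rewrite /Rintegral; have [->|st] := eqVneq s t; last by rewrite noise_prod_orth.
  under eq_integral do rewrite -expr2.
  by rewrite noise_prod_norm.
rewrite (_ : \int[P]_x 0 = 0); first by case: (s == t).
by rewrite /Rintegral integral0.
Qed.

End InnerProduct.

Section VonNeumannBounded.
Context (K : numFieldType) (E : preTopologicalLmodType K).

(* Bounded in the sense of von Neumann: absorbed by every neighborhood of 0. *)
Definition tvs_bounded (B : set E) : Prop :=
  forall U, nbhs (0 : E) U ->
    exists2 r : K, 0 < r & forall a : K, r <= `|a| -> B `<=` [set a *: x | x in U].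

End VonNeumannBounded.

Section TestSpace.
Context d (T : measurableType d) (R : realType) (P : probability T R).
Variable Z : normal_noise P.

Definition weight (s : {fset nat}) : R := \prod_(k <- s) k.+1%:R.

Definition sqnorm (p : R) (xi : L2 Z) : \bar R :=
  \esum_(s in [set: {fset nat}])
    (weight s `^ (2 * p) * normc (L2_inner (noise_L2 Z s) xi) ^+ 2)%:E.

Definition Sp (p : R) : set (L2 Z) := [set xi | (sqnorm p xi < +oo)%E].

Definition test_pred : {pred L2 Z} := mem (\bigcap_(p in [set p : R | 0 <= p]) Sp p).

Lemma test_predP xi : xi \in test_pred <->
  forall p, 0 <= p -> (sqnorm p xi < +oo)%E.
Proof. by rewrite /test_pred inE. Qed.

Let ge0_term p xi s :
  (0 <= (weight s `^ (2 * p) * normc (L2_inner (noise_L2 Z s) xi) ^+ 2)%:E)%E.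
Proof. by rewrite lee_fin mulr_ge0 ?powR_ge0 ?sqr_ge0. Qed.

Let ge0_esumZ (c : R) (a : {fset nat} -> \bar R) : 0 <= c -> (forall s, 0 <= a s)%E ->
  (\esum_(s in [set: {fset nat}]) (c%:E * a s) <= c%:E * \esum_(s in [set: {fset nat}]) a s)%E.
Proof.
move=> c0 a0; apply: ub_ereal_sup => _ /= [A fA <-].
rewrite -ge0_mule_fsumr//; apply: lee_wpmul2l; first by rewrite lee_fin.
by apply: ereal_sup_ubound; exists A.
Qed.

Lemma test_submod_closed : submod_closed test_pred.
Proof.
split.
  apply/test_predP => p _; rewrite /sqnorm esum1 ?ltry// => s _.
  rewrite -(scale0r (0 : L2 Z)) -[_ *: _]addr0 L2_inner_linear mul0r add0r.
  have -> : L2_inner (noise_L2 Z s) 0 = 0 :> R[i].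
    have := L2_inner_linear (noise_L2 Z s) 1 0 0.
    rewrite scale1r mul1r addr0 => /esym/eqP.
    by rewrite -subr_eq0 addrK => /eqP.
  by rewrite normc0 expr0n/= mulr0.
move=> a u v /test_predP Su /test_predP Sv; apply/test_predP => p p0.
have {}Su := Su p p0; have {}Sv := Sv p p0.
pose c : R := 2 * normc a ^+ 2.
apply: (@le_lt_trans _ _ (c%:E * sqnorm p u + 2%:E * sqnorm p v)%E); last first.
  apply: lte_add_pinfty; apply: lte_mul_pinfty; rewrite ?lee_fin.
  - by rewrite mulr_ge0 ?sqr_ge0.
  - by [].
  - exact: Su.
  - by [].
  - by [].
  - exact: Sv.
apply: le_trans (leeD (ge0_esumZ _ (ge0_term p u)) (ge0_esumZ _ (ge0_term p v))) => //; last first.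
  by rewrite mulr_ge0 ?sqr_ge0.
rewrite -esumD => [|s _|s _]; last 2 first.
- by rewrite mule_ge0 ?lee_fin ?ge0_term// mulr_ge0 ?sqr_ge0// powR_ge0.
- by rewrite mule_ge0 ?lee_fin ?ge0_term// mulr_ge0 ?sqr_ge0// powR_ge0.
apply: le_esum => s _; rewrite -!EFinM -EFinD lee_fin L2_inner_linear.
set x := L2_inner _ u; set y := L2_inner _ v; set w := _ `^ _.
rewrite [leRHS](_ : _ = w * (2 * normc (a * x) ^+ 2 + 2 * normc y ^+ 2)); last first.
  by rewrite normcM /c; ring.
rewrite ler_wpM2l ?powR_ge0// !normc_sqr; case: (a * x) y => [z1 z2] [y1 y2] /=.
rewrite -subr_ge0 [X in 0 <= X](_ : _ = (z1 - y1) ^+ 2 + (z2 - y2) ^+ 2); last by ring.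
by rewrite addr_ge0 ?sqr_ge0.
Qed.

HB.instance Definition _ := GRing.isSubmodClosed.Build R[i] (L2 Z)
  test_pred test_submod_closed.

Record test_space := TestSpace {
  test_val :> L2 Z ;
  _ : test_val \in test_pred }.

HB.instance Definition _ := [isSub for test_val].
HB.instance Definition _ := [Choice of test_space by <:].
HB.instance Definition _ := [SubChoice_isSubLmodule of test_space by <:].

Definition pnorm (p : R) (xi : test_space) : R := Num.sqrt (fine (sqnorm p xi)).

(* The topology generated by the norms pnorm p, p >= 0, has the balls of all
   these norms as a subbase. *)
Definition pnorm_balls : set (set test_space) :=
  [set B | exists p : R, 0 <= p /\ exists eta : test_space, exists r : R,
     B = [set xi | pnorm p (xi - eta) < r]].

HB.instance Definition _ :=
  @isSubBaseTopological.Build test_space (set test_space) pnorm_balls id.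

Lemma noise_test s : noise_L2 Z s \in test_pred.
Proof.
apply/test_predP => p _; rewrite /sqnorm.
rewrite (esumID [set s]); last by move=> t _; exact: ge0_term.
have -> : [set: {fset nat}] `&` [set s] = [set s].
  by apply/seteqP; split => [t []|t ts].
rewrite esum_set1; last exact: ge0_term.
rewrite esum1 => [|t [_ /eqP ts]]; first by rewrite adde0 ltry.
by rewrite noise_L2_orthonormal (negbTE ts) normc0 expr0n/= mulr0.
Qed.

Definition noise_elt (s : {fset nat}) : test_space := TestSpace (noise_test s).

End TestSpace.

Section ContinuousLinear.
Context (K : numFieldType) (E : preTopologicalLmodType K).

Definition continuous_linear : set (E -> K^o) :=
  [set f | linear f /\ continuous f].

Lemma continuous_linear0 : continuous_linear (0 : E -> K^o).
Proof.
split=> [b x y|]; last exact: cst_continuous.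
by rewrite -[RHS]/(b *: 0 + 0 : K^o) scaler0 addr0.
Qed.

Lemma continuous_linearD a (f g : E -> K^o) :
  continuous_linear f -> continuous_linear g -> continuous_linear (a *: f + g).
Proof.
move=> [fl fc] [gl gc]; split => [b x y|x].
  rewrite -[LHS]/(a *: f (b *: x + y) + g (b *: x + y)).
  rewrite -[RHS]/(b *: (a *: f x + g x) + (a *: f y + g y)).
  by rewrite fl gl !scalerDr !scalerA [b * a]mulrC addrACA.
apply: (@continuousD _ K^o); last exact: gc.
by apply: (@continuousZl_tmp _ K^o); exact: fc.
Qed.

End ContinuousLinear.

Section Dual.
Context d (T : measurableType d) (R : realType) (P : probability T R).
Variable Z : normal_noise P.

Definition dual_pred : {pred test_space Z -> R[i]^o} :=
  mem (@continuous_linear R[i] (test_space Z)).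

Lemma dual_submod_closed : submod_closed dual_pred.
Proof.
split=> [|a f g]; first by apply: mem_set; exact: continuous_linear0.
by move=> /set_mem fP /set_mem gP; apply: mem_set; exact: continuous_linearD.
Qed.

HB.instance Definition _ := GRing.isSubmodClosed.Build R[i]
  (test_space Z -> R[i]^o) dual_pred dual_submod_closed.

Record dual_space := DualSpace {
  dual_val :> test_space Z -> R[i]^o ;
  _ : dual_val \in dual_pred }.

HB.instance Definition _ := [isSub for dual_val].
HB.instance Definition _ := [Choice of dual_space by <:].
HB.instance Definition _ := [SubChoice_isSubLmodule of dual_space by <:].

(* The strong topology is that of uniform convergence on the bounded subsets of
   the test space. *)
Definition strong_embedding (Phi : dual_space) :
  {family @tvs_bounded _ (test_space Z), test_space Z -> R[i]^o} := Phi.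

HB.instance Definition _ :=
  Uniform.copy dual_space (initial_topology strong_embedding).

Definition fock (Phi : dual_space) (s : {fset nat}) : R[i] := Phi (noise_elt Z s).

End Dual.

(* Main.v *)
(* The operator is the transpose of the annihilation map that sends xi to the
   sum over t not containing k of <Z_(t U {k}), xi> Z_t. Its finite truncations
   T_F do not increase any norm p, since lambda_t <= lambda_(t U {k}) and
   t |-> t U {k} is injective on the t not containing k. A functional Phi is
   bounded by a multiple of some norm p, so Phi (T_F xi) is Cauchy along an
   exhaustion of the index set, and its limit defines (a Phi) xi; the sum itself
   need not be realized as an element of L^2. Since the truncations of the
   elements of a bounded set B form a bounded set B', uniform closeness on B' of
   two functionals passes to closeness on B of their images, which is strong
   continuity. *)

From HB Require Import structures.
Require Import Defs.
From mathcomp Require Import all_boot all_order all_algebra finmap.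
From mathcomp Require Import all_classical all_reals all_analysis complex.
From mathcomp Require Import ring lra.

Set Implicit Arguments.
Unset Strict Implicit.
Unset Printing Implicit Defensive.

Import Order.TTheory GRing.Theory Num.Theory.
Import numFieldNormedType.Exports.
Import ComplexField.Normc.

Local Open Scope classical_set_scope.
Local Open Scope ring_scope.

(** * The real-valued complex modulus, convergence of complex sequences, and termwise
    inequalities *)

Lemma normcE (R : realType) (z : R[i]) : `|z| = (normc z)%:C%C.
Proof. by []. Qed.

Lemma ltc_normcR (R : realType) (z : R[i]) (e : R) : (`|z| < e%:C%C) = (normc z < e).
Proof. by rewrite normcE ltcR. Qed.

Lemma normcR (R : realType) (x : R) : 0 <= x -> normc (x%:C%C) = x.
Proof. by move=> x0; rewrite /= expr0n addr0 sqrtr_sqr ger0_norm. Qed.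

Lemma normc_ge0 (R : realType) (z : R[i]) : 0 <= normc z.
Proof. by case: z => a b; exact: sqrtr_ge0. Qed.

Lemma normc_Re_le (R : realType) (z : R[i]) : `|complex.Re z| <= normc z.
Proof.
rewrite -ler_sqr ?nnegrE ?normc_ge0// normc_sqr real_normK ?num_real//.
by rewrite lerDl sqr_ge0.
Qed.

Lemma normc_Im_le (R : realType) (z : R[i]) : `|complex.Im z| <= normc z.
Proof.
rewrite -ler_sqr ?nnegrE ?normc_ge0// normc_sqr real_normK ?num_real//.
by rewrite lerDr sqr_ge0.
Qed.

Lemma normc_le_ReIm (R : realType) (z : R[i]) :
  normc z <= `|complex.Re z| + `|complex.Im z|.
Proof.
rewrite -ler_sqr ?nnegrE ?normc_ge0 ?addr_ge0// normc_sqr sqrrD.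
rewrite !real_normK ?num_real// -addrA addrCA lerDr -[X in 0 <= X]/(_ *+ 2).
by rewrite mulrn_wge0 // mulr_ge0.
Qed.

(** The tolerances of the metric on [R[i]] are elements of [R[i]]; a positive one has zero imaginary
    part, so real tolerances suffice. *)
Lemma cvg_normcP (R : realType) (u : nat -> R[i]^o) (l : R[i]^o) :
  u n @[n --> \oo] --> l <->
  forall e : R, 0 < e -> \forall n \near \oo, normc (l - u n) < e.
Proof.
split=> [/cvgrPdist_lt ul e e0|ul].
  have e0' : 0 < e%:C%C by rewrite ltcR.
  by have := ul _ e0'; apply: filterS => n; rewrite ltc_normcR.
apply/cvgrPdist_lt => -[e1 e2]; rewrite ltcE /= => /andP[/eqP -> e0].
by apply: filterS (ul _ e0) => n; rewrite -ltc_normcR.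
Qed.

(** Real and imaginary parts are bounded by the modulus, so both are Cauchy and converge by
    completeness of [R]; the two limits are then recombined. *)
Lemma is_cvg_normc_cauchy (R : realType) (u : nat -> R[i]^o) :
  (forall e : R, 0 < e -> exists N, forall n, (N <= n)%N -> normc (u n - u N) < e) ->
  cvgn u.
Proof.
move=> cu.
have cre : cvgn (fun n => complex.Re (u n)).
  apply: R_complete; apply: cauchy_exP => e e0.
  have [N uN] := cu e e0; exists (complex.Re (u N)); exists N => // n /= /uN.
  rewrite /ball /= distrC; apply: le_lt_trans; rewrite -raddfB; exact: normc_Re_le.
have cim : cvgn (fun n => complex.Im (u n)).
  apply: R_complete; apply: cauchy_exP => e e0.
  have [N uN] := cu e e0; exists (complex.Im (u N)); exists N => // n /= /uN.
  rewrite /ball /= distrC; apply: le_lt_trans; rewrite -raddfB; exact: normc_Im_le.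
move/cvg_ex : cre => [a /= /cvgrPdist_lt ca]; move/cvg_ex : cim => [b /= /cvgrPdist_lt cb].
apply/cvg_ex; exists (a +i* b)%C; apply/cvg_normcP => e e0.
have e20 : 0 < e / 2 by rewrite divr_gt0.
apply: filterS2 (ca _ e20) (cb _ e20) => n an bn.
apply: (le_lt_trans (normc_le_ReIm _)); rewrite [ltRHS]splitr !raddfB /=.
exact: ltrD.
Qed.

(** Young's inequality with a free parameter. It can be summed over the chaos coefficients, and a
    suitable [c] then yields the triangle inequality for [pnorm]. *)
Lemma normc_sqrD_le (R : realType) (x y : R[i]) (c : R) : 0 < c ->
  normc (x + y) ^+ 2 <= (1 + c) * normc x ^+ 2 + (1 + c^-1) * normc y ^+ 2.
Proof.
move=> c0; rewrite !normc_sqr; case: x y => [x1 x2] [y1 y2] /=.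
have E (u v : R) : (u + v) ^+ 2 <= (1 + c) * u ^+ 2 + (1 + c^-1) * v ^+ 2.
  rewrite -subr_ge0 [X in 0 <= X](_ : _ = c^-1 * (c * u - v) ^+ 2).
    by rewrite mulr_ge0 ?sqr_ge0 ?invr_ge0 ?ltW.
  by field; rewrite gt_eqF.
have := E x1 y1; have := E x2 y2; lra.
Qed.

Lemma le_esumZl (R : realType) (I : choiceType) (c : R) (a : I -> R) :
  0 <= c -> (forall i, 0 <= a i) ->
  (\esum_(i in setT) (c * a i)%:E <= c%:E * \esum_(i in setT) (a i)%:E)%E.
Proof.
move=> c0 a0; apply: ub_ereal_sup => _ /= [A fA <-].
under eq_fsbigr do rewrite EFinM.
rewrite -ge0_mule_fsumr//.
apply: lee_wpmul2l; first by rewrite lee_fin.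
by apply: ereal_sup_ubound; exists A.
Qed.

Lemma weight_ge1 (R : realType) (s : {fset nat}) : 1 <= weight R s.
Proof.
rewrite /weight; elim/big_ind: _ => // [x y x1 y1|i _]; last by rewrite ler1n.
by rewrite -[1]mulr1 ler_pM.
Qed.

(** * The norms of the test space and its neighborhoods of zero *)

Section Pnorm.
Context d (T : measurableType d) (R : realType) (P : probability T R).
Variable Z : normal_noise P.
Implicit Types (xi eta : test_space Z) (p r : R) (s t : {fset nat}).

Definition chaos_coef s xi : R[i] := L2_inner (noise_L2 Z s) xi.

Lemma chaos_coef_linear s : linear_for *%R (chaos_coef s).
Proof. by move=> a xi eta; rewrite /chaos_coef -L2_inner_linear. Qed.

HB.instance Definition _ s := GRing.isLinear.Build R[i] (test_space Z) R[i] *%R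
  (chaos_coef s) (chaos_coef_linear s).

Lemma chaos_coefZ s (a : R[i]) xi : chaos_coef s (a *: xi) = a * chaos_coef s xi.
Proof. exact: scalarZ. Qed.

Lemma chaos_coef_noise s t : chaos_coef s (noise_elt Z t) = (s == t)%:R.
Proof. exact: noise_L2_orthonormal. Qed.

Definition sqnorm_term p xi s : R := weight R s `^ (2 * p) * normc (chaos_coef s xi) ^+ 2.

Lemma sqnorm_term_ge0 p xi s : 0 <= sqnorm_term p xi s.
Proof. by rewrite mulr_ge0 ?powR_ge0 ?sqr_ge0. Qed.

Lemma sqnormE p xi : sqnorm p xi = (\esum_(s in setT) (sqnorm_term p xi s)%:E)%E.
Proof. by []. Qed.

Lemma sqnorm_fin p xi : 0 <= p -> (sqnorm p xi < +oo)%E.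
Proof. by move=> p0; have /test_predP := valP xi; exact. Qed.

Lemma pnorm_ge0 p xi : 0 <= pnorm p xi. Proof. exact: sqrtr_ge0. Qed.

Lemma sqnorm_pnorm p xi : 0 <= p -> sqnorm p xi = (pnorm p xi ^+ 2)%:E.
Proof.
move=> p0; have s0 : (0 <= sqnorm p xi)%E.
  by rewrite sqnormE esum_ge0// => s _; rewrite lee_fin sqnorm_term_ge0.
by rewrite /pnorm sqr_sqrtr ?fine_ge0// fineK// ge0_fin_numE ?sqnorm_fin.
Qed.

Lemma sqr_pnorm_le p xi (B : R) : 0 <= p ->
  (sqnorm p xi <= B%:E)%E -> pnorm p xi ^+ 2 <= B.
Proof. by move=> p0; rewrite sqnorm_pnorm// lee_fin. Qed.

Lemma pnorm_le p q xi : 0 <= p -> p <= q -> pnorm p xi <= pnorm q xi.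
Proof.
move=> p0 pq; have q0 := le_trans p0 pq.
rewrite -ler_sqr ?nnegrE ?pnorm_ge0//; apply: sqr_pnorm_le => //.
have := sqnorm_pnorm xi q0; move: (pnorm q xi ^+ 2) => B <-.
rewrite !sqnormE; apply: le_esum => s _; rewrite lee_fin ler_wpM2r ?sqr_ge0//.
by rewrite ler_powR ?weight_ge1// ler_pM2l.
Qed.

Lemma sqr_pnormD_le p xi eta (X Y c : R) : 0 <= p -> 0 < c ->
  sqnorm p xi = X%:E -> sqnorm p eta = Y%:E ->
  pnorm p (xi + eta) ^+ 2 <= (1 + c) * X + (1 + c^-1) * Y.
Proof.
move=> p0 c0 EX EY; apply: sqr_pnorm_le => //.
rewrite EFinD 2!EFinM -EX -EY !sqnormE.
have c1 : 0 <= 1 + c by rewrite addr_ge0 ?ltW.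
have c2 : 0 <= 1 + c^-1 by rewrite addr_ge0 ?invr_ge0 ?ltW.
apply: le_trans (leeD (le_esumZl c1 (sqnorm_term_ge0 p xi)) (le_esumZl c2 (sqnorm_term_ge0 p eta))).
rewrite -esumD => [|s _|s _]; last 2 first.
- by rewrite lee_fin mulr_ge0 ?sqnorm_term_ge0.
- by rewrite lee_fin mulr_ge0 ?sqnorm_term_ge0.
apply: le_esum => s _; rewrite -EFinD lee_fin /sqnorm_term [chaos_coef s _](raddfD (chaos_coef s)).
rewrite ![_ * (weight R s `^ _ * _)]mulrCA -mulrDr.
apply: ler_wpM2l; first exact: powR_ge0.
exact: normc_sqrD_le.
Qed.

Lemma pnormD_lt p xi eta (x y : R) : 0 <= p -> pnorm p xi < x -> pnorm p eta < y ->
  pnorm p (xi + eta) < x + y.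
Proof.
move=> p0 px py.
have x0 : 0 < x by apply: le_lt_trans px; exact: pnorm_ge0.
have y0 : 0 < y by apply: le_lt_trans py; exact: pnorm_ge0.
(* This is the value for which (1 + c) x^2 + (1 + 1/c) y^2 equals (x + y)^2. *)
set c := y / x; have c0 : 0 < c by rewrite divr_gt0.
rewrite -ltr_sqr ?nnegrE ?pnorm_ge0 ?addr_ge0 ?ltW//.
apply: (le_lt_trans (sqr_pnormD_le p0 c0 (sqnorm_pnorm xi p0) (sqnorm_pnorm eta p0))).
rewrite [ltRHS](_ : _ = (1 + c) * x ^+ 2 + (1 + c^-1) * y ^+ 2); last first.
  by rewrite /c; field; rewrite !gt_eqF.
rewrite ltrD// ltr_pM2l ?addr_gt0 ?invr_gt0// ltr_sqr ?nnegrE ?pnorm_ge0 ?ltW//.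
Qed.

Lemma pnormZ_le p (a : R[i]) xi : 0 <= p -> pnorm p (a *: xi) <= normc a * pnorm p xi.
Proof.
move=> p0; rewrite -ler_sqr ?nnegrE ?mulr_ge0 ?normc_ge0 ?pnorm_ge0//.
rewrite exprMn; apply: sqr_pnorm_le => //.
have := sqnorm_pnorm xi p0; move: (pnorm p xi ^+ 2) => X EX.
rewrite EFinM -EX !sqnormE.
apply: le_trans (le_esumZl (sqr_ge0 _) (sqnorm_term_ge0 p xi)).
apply: le_esum => s _; rewrite lee_fin /sqnorm_term chaos_coefZ normcM exprMn.
by rewrite mulrCA.
Qed.

Lemma pnorm0 p : 0 <= p -> pnorm p (0 : test_space Z) = 0.
Proof.
move=> p0; apply/eqP; rewrite eq_le pnorm_ge0 andbT.
by have := pnormZ_le 0 0 p0; rewrite scale0r normc0 mul0r.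
Qed.

Lemma nbhs_pnorm_ball p r xi : 0 <= p -> 0 < r ->
  nbhs xi [set eta | pnorm p (eta - xi) < r].
Proof.
move=> p0 r0; apply: open_nbhs_nbhs; split; last by rewrite /= subrr pnorm0.
exists [set [set eta | pnorm p (eta - xi) < r]]; last by rewrite bigcup_set1.
by move=> _ ->; apply: finI_from1; exists p; split => //; exists xi, r.
Qed.

Lemma nbhs0_pnorm_ball p r : 0 <= p -> 0 < r ->
  nbhs (0 : test_space Z) [set eta : test_space Z | pnorm p eta < r].
Proof.
move=> p0 r0; have <- : [set eta | pnorm p (eta - 0) < r] =
    [set eta : test_space Z | pnorm p eta < r].
  by apply/funext => eta; rewrite /= subr0.
exact: nbhs_pnorm_ball.
Qed.

(** Balls of the subbase may have any centre. With [eta] the opposite of the centre, this finds a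
    ball around 0 inside a ball that contains 0. *)
Lemma pnorm_ball_shift p eta r : 0 <= p -> pnorm p eta < r ->
  exists2 r', 0 < r' & forall xi, pnorm p xi < r' -> pnorm p (xi + eta) < r.
Proof.
(* The midpoint supplies the strict bound on the norm of [eta] that [pnormD_lt] requires. *)
move=> p0 etar; have [/= e1 e2] := midf_lt etar.
exists (r - (pnorm p eta + r) / 2) => [|xi xir]; first by rewrite subr_gt0.
by have := pnormD_lt p0 xir e1; rewrite subrK.
Qed.

(** A basic neighborhood is a finite intersection of subbase balls, each of which contains a ball
    around 0. Since [pnorm p] grows with [p], the largest index and the smallest radius serve for
    all of them, so a single norm suffices. *)
Lemma nbhs0_pnorm (U : set (test_space Z)) : nbhs (0 : test_space Z) U ->
  exists p r, [/\ 0 <= p, 0 < r & [set xi : test_space Z | pnorm p xi < r] `<=` U].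
Proof.
rewrite nbhsE => -[V [[D' sD' <-] [W D'W W0]] VU].
have [F FD WE] := sD' _ D'W.
suff [p [r [p0 r0 pr]]] : exists p r, [/\ 0 <= p, 0 < r &
    [set xi : test_space Z | pnorm p xi < r] `<=` W].
  by exists p, r; split => // xi /pr Wxi; apply: VU; exists W.
move: W0; rewrite -WE => F0.
have FF B : B \in F -> exists p r, [/\ 0 <= p, 0 < r &
    [set xi : test_space Z | pnorm p xi < r] `<=` B].
  move=> BF; have := FD _ BF; rewrite inE => -[p [p0 [eta [r BE]]]].
  have := F0 B BF; rewrite BE /= sub0r => /(pnorm_ball_shift p0)[r' r'0 h].
  by exists p, r'; split => // xi /= /h.
have {F0 FF} : forall l : seq (set (test_space Z)), {subset l <= F} ->
    exists p r, [/\ 0 <= p, 0 < r & forall B, B \in l ->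
      [set xi : test_space Z | pnorm p xi < r] `<=` B].
  elim=> [|B l IH] sF; first by exists 0, 1; split.
  have [|p [r [p0 r0 pr]]] := IH; first by move=> C Cl; apply: sF; rewrite inE Cl orbT.
  have [|q [s [q0 s0 qs]]] := FF B; first by apply: sF; rewrite mem_head.
  exists (Num.max p q), (Num.min r s); split => [||C].
  - by rewrite le_max p0.
  - by rewrite lt_min r0.
  rewrite inE => /orP[/eqP ->|Cl] xi /=; rewrite lt_min => /andP[xr xs].
    by apply: qs => /=; apply: le_lt_trans xs; apply: pnorm_le => //; rewrite le_max lexx orbT.
  by apply: (pr _ Cl) => /=; apply: le_lt_trans xr; apply: pnorm_le => //; rewrite le_max lexx.
move=> /(_ (enum_fset F)) [//|p [r [p0 r0 pr]]].
by exists p, r; split => // xi xir B /= BF; exact: (pr B).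
Qed.

End Pnorm.

(** * Continuity of functionals as a bound by a single norm *)

Section Functionals.
Context d (T : measurableType d) (R : realType) (P : probability T R).
Variable Z : normal_noise P.
Implicit Types (xi eta : test_space Z) (p r : R).

Lemma dual_linear (Phi : dual_space Z) : linear (Phi : test_space Z -> R[i]^o).
Proof. by have /set_mem[] := valP Phi. Qed.

HB.instance Definition _ (Phi : dual_space Z) :=
  GRing.isLinear.Build R[i] (test_space Z) R[i]^o *:%R (dual_val Phi) (dual_linear Phi).

(** Continuity at 0 with tolerance 1 gives a ball of radius [r] on which the modulus of [Phi] is
    below 1; rescaling into this ball gives the constant [r^-1]. *)
Lemma dual_bounded (Phi : dual_space Z) : exists p C : R,
  [/\ 0 <= p, 0 < C & forall xi, normc (Phi xi) <= C * pnorm p xi].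
Proof.
have /set_mem[_ /(_ 0)/cvgrPdist_lt /(_ 1 ltr01)] := valP Phi.
have -> : \val Phi 0 = 0 by exact: (linear0 Phi).
move=> /nbhs0_pnorm[p [r [p0 r0 pr]]].
exists p, r^-1; split => //; first by rewrite invr_gt0.
move=> xi; apply/ler_addgt0Pr => e e0.
(* The summand [r * e] keeps the scaling factor [r / x] meaningful when the norm of [xi] vanishes,
   and costs exactly [e] in the final bound. *)
have x0 : 0 < pnorm p xi + r * e by rewrite ltr_wpDl ?pnorm_ge0 ?mulr_gt0.
set x := _ + _ in x0.
have a0 : 0 < r / x by rewrite divr_gt0.
have : pnorm p ((r / x)%:C%C *: xi) < r.
  apply: (le_lt_trans (pnormZ_le _ _ p0)); rewrite normcR ?ltW//.
  by rewrite mulrAC ltr_pdivrMr// ltr_pM2l// /x ltrDl mulr_gt0.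
move=> /pr /=; rewrite sub0r normrN linearZ /= -[1](rmorph1 (@real_complex R)) ltc_normcR.
rewrite normcM (normcR (ltW a0)) -ltr_pdivlMl// invf_div mulr1 => /ltW h; apply: le_trans h _.
by rewrite /x mulrDl mulrAC divff ?gt_eqF// mul1r mulrC.
Qed.

Lemma bounded_continuous (f : test_space Z -> R[i]^o) p (C : R) : linear f ->
  0 <= p -> 0 < C -> (forall xi, normc (f xi) <= C * pnorm p xi) ->
  continuous_linear f.
Proof.
move=> fl p0 C0 fC; split => // xi; have FF := @nbhs_filter (test_space Z) xi.
apply/(@cvgrPdist_lt R[i] R[i]^o _ _ FF) => -[e1 e2].
rewrite ltcE /= => /andP[/eqP -> e0].
have eC : 0 < e1 / C by rewrite divr_gt0.
have := nbhs_pnorm_ball xi p0 eC; apply: (@filterS _ (nbhs xi)) => eta /= h.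
rewrite distrC ltc_normcR.
have -> : f eta - f xi = f (eta - xi).
  by rewrite [eta - xi]addrC; have := fl (-1) xi eta; rewrite !scaleN1r => ->; rewrite addrC.
by apply: (le_lt_trans (fC _)); rewrite -ltr_pdivlMl// mulrC.
Qed.

End Functionals.

(** * Finite truncations of the annihilation map *)

Section Truncation.
Context d (T : measurableType d) (R : realType) (P : probability T R).
Variables (Z : normal_noise P) (k : nat).
Implicit Types (xi eta : test_space Z) (p r : R) (s t : {fset nat}).
Implicit Types F G : {fset {fset nat}}.

Definition ann_coef t xi : R[i] := (k \notin t)%:R * chaos_coef (k |` t)%fset xi.

Lemma ann_coef_linear t : linear_for *%R (ann_coef t).
Proof.
move=> a xi eta; rewrite /ann_coef [chaos_coef _ _](linearP (chaos_coef _)).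
by rewrite mulrDr mulrCA.
Qed.

HB.instance Definition _ t := GRing.isLinear.Build R[i] (test_space Z) R[i] *%R
  (ann_coef t) (ann_coef_linear t).

(** The conditions that [t] avoids [k] and that adding [k] to [t] gives [s] hold together exactly
    when [s] contains [k] and [t] is [s] without [k]. *)
Lemma ann_coef_noise t s :
  ann_coef t (noise_elt Z s) = (k \in s)%:R * (t == s `\ k)%fset%:R.
Proof.
rewrite /ann_coef chaos_coef_noise -!natrM !mulnb; congr (nat_of_bool _)%:R.
apply/andP/andP => [[kt /eqP <-]|[ks /eqP ->]].
  by rewrite fset1U1 fsetU1K// eqxx.
by rewrite fsetD1K// eqxx !inE eqxx.
Qed.

Definition ann_trunc F xi : test_space Z :=
  \sum_(t <- F) ann_coef t xi *: noise_elt Z t.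

Lemma ann_trunc_linear F : linear (ann_trunc F).
Proof.
move=> a xi eta; rewrite /ann_trunc scaler_sumr -big_split /=.
by apply: eq_bigr => t _; rewrite ann_coef_linear scalerDl scalerA.
Qed.

HB.instance Definition _ F := GRing.isLinear.Build R[i] (test_space Z) (test_space Z) *:%R
  (ann_trunc F) (ann_trunc_linear F).

Definition ann_term p xi t : R := weight R t `^ (2 * p) * normc (ann_coef t xi) ^+ 2.

Lemma ann_term_ge0 p xi t : 0 <= ann_term p xi t.
Proof. by rewrite mulr_ge0 ?powR_ge0 ?sqr_ge0. Qed.

Lemma chaos_coef_ann_trunc F xi t : chaos_coef t (ann_trunc F xi) = (t \in F)%:R * ann_coef t xi.
Proof.
have -> : chaos_coef t (ann_trunc F xi) = \sum_(s <- F) ann_coef s xi * (t == s)%:R.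
  rewrite /ann_trunc [LHS](linear_sum (chaos_coef t)); apply: eq_bigr => s _.
  by rewrite -(chaos_coef_noise Z); exact: chaos_coefZ.
have [tF|tF] := boolP (t \in F).
  rewrite (big_fsetD1 t)//= eqxx mulr1 mul1r big1_fset ?addr0// => s.
  by rewrite !inE => /andP[/negbTE st _] _; rewrite eq_sym st mulr0.
rewrite mul0r big1_fset// => s sF _.
by case: eqVneq tF => [->|]; rewrite ?sF ?mulr0.
Qed.

(** The chaos coefficients of the truncation vanish outside [F], so the series of the squared norm
    is a finite sum. *)
Lemma sqr_pnorm_ann_trunc p F xi : 0 <= p ->
  pnorm p (ann_trunc F xi) ^+ 2 = \sum_(t <- F) ann_term p xi t.
Proof.
move=> p0; apply: EFin_inj; rewrite -sqnorm_pnorm// sqnormE.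
have E t : (sqnorm_term p (ann_trunc F xi) t)%:E =
    (if t \in [set` F] then (ann_term p xi t)%:E else 0)%E.
  rewrite /sqnorm_term chaos_coef_ann_trunc mem_setE.
  by case: (t \in F); rewrite ?mul1r// mul0r normc0 expr0n mulr0.
rewrite (eq_esum (fun t _ => E t)) -esum_mkcond esum_fset//; last first.
  by move=> t _; rewrite lee_fin ann_term_ge0.
by rewrite fsbig_finite//= set_fsetK sumEFin.
Qed.

Lemma weightU1 t : k \notin t -> weight R t <= weight R (k |` t)%fset.
Proof.
move=> kt; rewrite /weight big_fsetU1//= ler_peMl ?ler1n//.
exact: le_trans (weight_ge1 _ _).
Qed.

Lemma sum_ann_term_le p F xi : 0 <= p ->
  \sum_(t <- F) ann_term p xi t <= pnorm p xi ^+ 2.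
Proof.
move=> p0; rewrite -lee_fin -sqnorm_pnorm// sqnormE -sumEFin.
pose A := [fset t in F | k \notin t]%fset.
(* Terms with [k] in [t] are zero; on the remaining index set [A], adding [k] is injective, so the
   sum can be compared with distinct terms of the squared norm of [xi]. *)
have AE : (\sum_(t <- F) (ann_term p xi t)%:E = \sum_(t <- A) (ann_term p xi t)%:E)%E.
  rewrite (bigID (fun t => k \notin t)) /= [X in (_ + X)%E]big1; last first.
    move=> t /negPn kt.
    by rewrite /ann_term /ann_coef kt mul0r normc0 expr0n mulr0.
  by rewrite adde0 big_fset_condE.
rewrite AE.
apply: (@le_trans _ _ (\sum_(s <- [fset (k |` t)%fset | t in A]%fset) (sqnorm_term p xi s)%:E)%E).
  rewrite [leRHS]big_imfset /=; last first.
    move=> t u /=; rewrite !inE => /andP[_ kt] /andP[_ ku] tu.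
    by rewrite -(fsetU1K kt) tu fsetU1K.
  rewrite big_seq [leRHS]big_seq; apply: lee_sum => t.
  rewrite !inE => /andP[_ kt]; rewrite lee_fin /ann_term /ann_coef kt mul1r.
  rewrite ler_wpM2r ?sqr_ge0// ge0_ler_powR ?nnegrE ?mulr_ge0 ?weightU1//;
    exact: le_trans (weight_ge1 _ _).
apply: esum_ge; exists [set` [fset (k |` t)%fset | t in A]%fset]; first by split.
by rewrite fsbig_finite//= set_fsetK.
Qed.

Lemma pnorm_ann_trunc p F xi : 0 <= p -> pnorm p (ann_trunc F xi) <= pnorm p xi.
Proof.
move=> p0; rewrite -ler_sqr ?nnegrE; [|exact: pnorm_ge0|exact: pnorm_ge0].
apply: le_trans (sum_ann_term_le F xi p0).
by rewrite (sqr_pnorm_ann_trunc F xi p0).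
Qed.

(** The scalars that absorb [B] into a ball of one norm also absorb its truncations, because
    truncations are linear and map the ball into itself. The radius does not depend on the
    truncation, so all of them are taken at once. *)
Lemma ann_trunc_bounded (B : set (test_space Z)) : tvs_bounded B ->
  tvs_bounded [set ann_trunc F.1 F.2 | F in [set: {fset {fset nat}}] `*` B].
Proof.
move=> bB U /nbhs0_pnorm[p [r [p0 r0 prU]]].
have [c c0 Bc] := bB _ (nbhs0_pnorm_ball Z p0 r0).
exists c => // a /Bc BU _ [[F xi] [_ /= /BU[eta /= er <-]] <-].
exists (ann_trunc F eta); last by rewrite linearZ.
by apply: prU => /=; apply: le_lt_trans er; exact: pnorm_ann_trunc.
Qed.

End Truncation.

(** * Exhaustion of the countable index set by the indices with small code *)

Definition initial_fsets n : {fset {fset nat}} :=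
  [fset s in pmap (@pickle_inv {fset nat}) (iota 0 n)]%fset.

Lemma mem_initial_fsets n s : (s \in initial_fsets n) = (choice.pickle s < n)%N.
Proof.
rewrite !inE /= (can2_mem_pmap (@pickle_invK _) (@pickleK_inv _)).
by rewrite mem_iota.
Qed.

Lemma big_initial_fsets (V : nmodType) (f : {fset nat} -> V) n m : (n <= m)%N ->
  \sum_(s <- initial_fsets m) f s = \sum_(s <- initial_fsets n) f s +
    \sum_(s <- [fset s in initial_fsets m | s \notin initial_fsets n]%fset) f s.
Proof.
move=> nm; rewrite (big_fsetID _ (mem (initial_fsets n))) /=; congr (_ + _).
congr (\sum_(s <- enum_fset _) f s); apply/fsetP => s.
rewrite in_fset_ /= inE !mem_initial_fsets.
by apply: andb_idl => /leq_trans; exact.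
Qed.

(** * The creation operator as a limit, its Fock transform and its strong continuity *)

Section Adjoint.
Context d (T : measurableType d) (R : realType) (P : probability T R).
Variables (Z : normal_noise P) (k : nat).
Implicit Types (xi eta : test_space Z) (Phi Psi : dual_space Z).

(** The partial sums [S] of the squared norm increase and are bounded by that of [xi], hence
    converge. The difference of two values of [Phi] is its value at the truncation to the indices in
    between, whose squared norm is an increment of [S]. *)
Lemma is_cvg_ann_trunc Phi xi :
  cvgn (fun n => Phi (ann_trunc k (initial_fsets n) xi) : R[i]^o).
Proof.
have [p [C [p0 C0 PhiC]]] := dual_bounded Phi.
pose S n := \sum_(s <- initial_fsets n) ann_term k p xi s.
have ndS : {homo S : n m / (n <= m)%N >-> n <= m}.
  move=> n m nm; rewrite /S (big_initial_fsets _ nm) lerDl.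
  by apply: sumr_ge0 => s _; exact: ann_term_ge0.
have cS : cvgn S.
  apply: nondecreasing_is_cvgn => //; exists (pnorm p xi ^+ 2) => _ [n _ <-].
  exact: sum_ann_term_le.
apply: is_cvg_normc_cauchy => e e0.
have eC : 0 < e / C by rewrite divr_gt0.
have eC2 : 0 < (e / C) ^+ 2 by rewrite exprn_gt0.
have [N _ NS] := (cvgrPdist_lt _ _).1 cS _ eC2.
exists N => n Nn.
set G := [fset s in initial_fsets n | s \notin initial_fsets N]%fset.
have -> : Phi (ann_trunc k (initial_fsets n) xi) -
    Phi (ann_trunc k (initial_fsets N) xi) = Phi (ann_trunc k G xi).
  rewrite -[LHS](linearB Phi); congr (Phi _).
  by rewrite /ann_trunc (big_initial_fsets _ Nn) addrC addKr.
apply: (le_lt_trans (PhiC _)); rewrite -ltr_pdivlMl// mulrC.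
rewrite -ltr_sqr ?nnegrE; [|exact: pnorm_ge0|exact: ltW].
rewrite (sqr_pnorm_ann_trunc _ _ _ p0).
have -> : \sum_(s <- G) ann_term k p xi s = S n - S N.
  by rewrite /S (big_initial_fsets _ Nn) addrC addKr.
(* [S n] lies below the limit of [S], so the increment is at most the distance of [S N] from that
   limit. *)
apply: le_lt_trans (NS N (leqnn N)).
apply: le_trans (ler_norm _); rewrite lerB//.
exact: nondecreasing_cvgn_le.
Qed.

Definition creation_fun Phi xi : R[i]^o :=
  limn (fun n => Phi (ann_trunc k (initial_fsets n) xi) : R[i]^o).

Lemma cvg_creation_fun Phi xi :
  (Phi (ann_trunc k (initial_fsets n) xi) : R[i]^o) @[n --> \oo] --> creation_fun Phi xi.
Proof. exact: is_cvg_ann_trunc. Qed.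

Lemma creation_fun_unique Phi xi (l : R[i]^o) :
  (Phi (ann_trunc k (initial_fsets n) xi) : R[i]^o) @[n --> \oo] --> l ->
  creation_fun Phi xi = l.
Proof. exact: cvg_lim. Qed.

Lemma creation_fun_linear Phi : linear (creation_fun Phi).
Proof.
move=> a xi eta; apply: creation_fun_unique.
under eq_fun do rewrite 2!linearP.
apply: cvgD; last exact: cvg_creation_fun.
by apply: (@cvgZl_tmp _ R[i]^o); exact: cvg_creation_fun.
Qed.

Lemma creation_fun_approx Phi xi (e : R) : 0 < e -> exists n,
  normc (creation_fun Phi xi - Phi (ann_trunc k (initial_fsets n) xi)) < e.
Proof.
move=> e0; have /cvg_normcP/(_ _ e0)[N _ h] := @cvg_creation_fun Phi xi.
by exists N; exact: (h N (leqnn N)).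
Qed.

(** The bound of [Phi], with the same index and constant, holds along all truncations and passes to
    the limit. *)
Lemma creation_fun_continuous Phi : continuous_linear (creation_fun Phi).
Proof.
have [p [C [p0 C0 PhiC]]] := dual_bounded Phi.
apply: (@bounded_continuous _ _ _ _ _ _ p C) => // [|xi].
  exact: creation_fun_linear.
apply/ler_addgt0Pl => e e0; have [n ln] := creation_fun_approx Phi xi e0.
rewrite -(subrK (Phi (ann_trunc k (initial_fsets n) xi)) (creation_fun Phi xi)).
apply: (le_trans (le_normcD _ _)); apply: lerD; first exact: ltW.
apply: (le_trans (PhiC _)); apply: ler_wpM2l; first exact: ltW.
exact: pnorm_ann_trunc.
Qed.

Definition creation Phi : dual_space Z := DualSpace (mem_set (creation_fun_continuous Phi)).

Lemma creation_linear : linear creation.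
Proof.
move=> a Phi Psi; apply: val_inj; apply/funext => xi.
apply: creation_fun_unique.
exact: (cvgD (cvgZl_tmp (k := a) (@cvg_creation_fun Phi xi)) (@cvg_creation_fun Psi xi)).
Qed.

HB.instance Definition _ :=
  GRing.isLinear.Build R[i] (dual_space Z) (dual_space Z) *:%R creation creation_linear.

(** At a basis element the truncations are eventually constant: at most the index [s] without [k]
    contributes, and it belongs to the exhaustion once [n] exceeds its code. *)
Lemma fock_creation Phi s : fock (creation Phi) s = (k \in s)%:R * fock Phi (s `\ k)%fset.
Proof.
apply: creation_fun_unique; apply/cvg_normcP => e e0.
exists (choice.pickle (s `\ k)%fset).+1 => // n /= sn.
suff -> : ann_trunc k (initial_fsets n) (noise_elt Z s) =
    (k \in s)%:R *: noise_elt Z (s `\ k)%fset.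
  by rewrite linearZ subrr normc0.
rewrite /ann_trunc (big_fsetD1 (s `\ k)%fset) ?mem_initial_fsets//=.
rewrite ann_coef_noise eqxx mulr1 big1_fset ?addr0// => t.
rewrite !inE => /andP[/negbTE ts _] _.
by rewrite ann_coef_noise ts mulr0 scale0r.
Qed.

Lemma creation_continuous : continuous creation.
Proof.
apply: continuous_comp_initial => Phi.
have FF : Filter ((@strong_embedding _ _ _ _ Z \o creation) @ Phi).
  exact: (@fmap_filter _ _ _ _ (nbhs_filter Phi)).
apply: ((fam_cvgP _ (strong_embedding (creation Phi)) FF).2 _) => B bB U /uniform_nbhs[E [entE EU]].
move: entE; rewrite -entourage_ballE => -[-[e1 e2] /=].
rewrite ltcE /= => /andP[/eqP -> e0] eE.
have e20 : 0 < (e1 / 2)%:C%C by rewrite ltcR divr_gt0.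
(* Strong neighborhood of [Phi]: functionals within half the tolerance of it on the bounded set of
   all truncations of [B]. *)
have V := fam_nbhs (strong_embedding Phi)
  (entourage_ball R[i]^o (PosNum e20)) (ann_trunc_bounded k bB).
have := @initial_continuous _ _ (@strong_embedding _ _ _ _ Z) Phi _ V.
apply: (@filterS _ (nbhs Phi)) => Psi /= h; apply: EU => xi Bxi; apply: eE.
change (`|creation_fun Phi xi - creation_fun Psi xi| < e1%:C%C); rewrite ltc_normcR.
have -> : creation_fun Phi xi - creation_fun Psi xi = creation_fun (Phi - Psi) xi.
  exact/esym/(congr1 (fun f : dual_space Z => f xi) (linearB creation Phi Psi)).
have e12 : 0 < e1 / 2 by rewrite divr_gt0.
(* The stage [n] depends on [xi], but the estimate on the truncations of [B] is uniform over all
   stages. *)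
have [n ln] := creation_fun_approx (Phi - Psi) xi e12.
rewrite -(subrK ((Phi - Psi) (ann_trunc k (initial_fsets n) xi)) (creation_fun _ xi)).
rewrite [ltRHS]splitr; apply: (le_lt_trans (le_normcD _ _)); apply: ltrD => //.
rewrite -ltc_normcR; apply: h.
by exists (initial_fsets n, xi).
Qed.

End Adjoint.

Theorem theorem3p3 (d : measure_display) (T : measurableType d) (R : realType)
    (P : probability T R) (Z : normal_noise P)
    (chaosZ : chaotic_representation Z) (k : nat) :
  exists a : {linear dual_space Z -> dual_space Z},
    continuous a /\
    forall (s : {fset nat}) (Phi : dual_space Z),
      fock (a Phi) s = (k \in s)%:R * fock Phi (s `\ k)%fset.
Proof.
exists (@creation _ _ _ _ Z k); split; first exact: creation_continuous.
by move=> s Phi; exact: fock_creation.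
Qed.
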